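(* Let $A\subset\omega^\omega$ and suppose $A=\mathrm{p}(B)$ for a set $B\subset\omega^\omega\times\omega^\omega$. Then: (i) If Player I has a winning strategy in the game $G^{**}_p(B)$, then there is a nonempty open set $G\subset\omega^\omega$ such that $A$ is comeager in $G$. (ii) If Player II has a winning strategy in the game $G^{**}_p(B)$, then $A$ is meager.
   Context: $\omega^\omega$ is the Baire space with its usual product topology. $\mathrm{p}(B)=\{f\in\omega^\omega : \exists g\in\omega^\omega\ (f,g)\in B\}$. Meager means a countable union of nowhere dense sets. For an open set $G$, $A$ is comeager in $G$ if $G\setminus A$ is meager. The game $G^{**}_p(B)$: Players I and II alternate with perfect information. Player I plays $(n_0,u_0)$, II plays $u_1$, I plays $(n_2,u_2)$, II plays $u_3$, I plays $(n_4,u_4)$, and so on, where each $n_{2i}\in\omega$ and each $u_i$ is a nonempty finite sequence of natural numbers. Let $g=(n_0,n_2,n_4,\ldots)\in\omega^\omega$ and $f=u_0\cdot u_1\cdot u_2\cdots\in\omega^\omega$ (the dot denotes concatenation of sequences). Player I wins if $(f,g)\in B$; otherwise Player II wins. Strategies and winning strategies are understood in the usual sense. *)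

(* Defs.v *)
From HB Require Import structures.
From mathcomp Require Import all_boot all_classical.
From mathcomp Require Import topology.

Set Implicit Arguments.
Unset Strict Implicit.
Unset Printing Implicit Defensive.

Local Open Scope classical_set_scope.

Definition baire_space : Type := prod_topology (fun _ : nat => nat).

HB.instance Definition _ := Pointed.on baire_space.
HB.instance Definition _ := Nbhs.on baire_space.
HB.instance Definition _ := Topological.on baire_space.
HB.instance Definition _ := Uniform.on baire_space.

Section Category.
Context {T : topologicalType}.
Implicit Types A G : set T.

Definition nowhere_dense A := interior (closure A) = set0.

Definition meager A :=
  exists F : nat -> set T, (forall n, nowhere_dense (F n)) /\ A = \bigcup_n F n.

Definition comeager_in G A := meager (G `\` A).

End Category.

(* Two-player games of length omega with perfect information: in round [i],
   Player I plays [x i : X] and then Player II plays [y i : Y].  A strategy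
   takes the whole position reached so far: the list of completed rounds and,
   for Player II, the move that Player I has just made. *)
Section Games.
Variables X Y : Type.
Implicit Types (x : nat -> X) (y : nat -> Y) (W : (nat -> X) -> (nat -> Y) -> Prop).

Definition rounds x y (n : nat) : seq (X * Y) := mkseq (fun i => (x i, y i)) n.

Definition strategyI : Type := seq (X * Y) -> X.
Definition strategyII : Type := seq (X * Y) -> X -> Y.

Definition followsI (s : strategyI) x y := forall i, x i = s (rounds x y i).
Definition followsII (t : strategyII) x y :=
  forall i, y i = t (rounds x y i) (x i).

(* [W x y]: Player I wins the play [(x, y)]; otherwise Player II does. *)
Definition winningI W (s : strategyI) := forall x y, followsI s x y -> W x y.
Definition winningII W (t : strategyII) :=
  forall x y, followsII t x y -> ~ W x y.

Definition I_has_winning_strategy W := exists s, winningI W s.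
Definition II_has_winning_strategy W := exists t, winningII W t.

End Games.

Definition nonempty_seq : Type := {u : seq nat | u != [::]}.

(* The infinite concatenation u 0 . u 1 . u 2 ...: all the [u i] being
   nonempty, the first [k.+1] of them already determine the entry [k]. *)
Definition concat (u : nat -> nonempty_seq) : baire_space :=
  fun k => nth 0 (flatten (mkseq (fun i => val (u i)) k.+1)) k.

Lemma concat_prefix (u : nat -> nonempty_seq) (n : nat) :
  let s := flatten (mkseq (fun i => val (u i)) n) in
  mkseq (concat u) (size s) = s.
Proof.
set pre := fun n => flatten (mkseq (fun i => val (u i)) n).
have preS m : pre m.+1 = pre m ++ val (u m).
  by rewrite /pre /mkseq -addn1 iotaD map_cat flatten_cat /= cats0.
have sizeS m : size (pre m) < size (pre m.+1).
  rewrite preS size_cat -[X in X < _]addn0 ltn_add2l.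
  by case: (u m) => -[].
have size_ge m : m <= size (pre m).
  by elim: m => // m IHm; apply: leq_ltn_trans IHm (sizeS m).
have preD m d k : k < size (pre m) -> nth 0 (pre (m + d)) k = nth 0 (pre m) k.
  move=> km; elim: d => [|d IHd]; first by rewrite addn0.
  have kmd : k < size (pre (m + d)).
    apply: (leq_trans km); elim: d {IHd} => [|d IHd]; first by rewrite addn0.
    by rewrite addnS; apply: leq_trans IHd (ltnW (sizeS _)).
  by rewrite addnS preS nth_cat kmd IHd.
rewrite /= -/(pre n); apply: (@eq_from_nth _ 0); rewrite size_mkseq // => k kn.
rewrite nth_mkseq // /concat -/(pre k.+1).
case: (leqP k.+1 n) => [le|/ltnW le].
  by rewrite -(subnKC le) preD // size_ge.
by rewrite -(subnKC le) preD.
Qed.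

Section UnfoldedGame.
Variable B : set (baire_space * baire_space).

(* In round [i] Player I plays [x i = (n_(2i), u_(2i))] and Player II plays
   [y i = u_(2i+1)]. *)
Implicit Types (x : nat -> nat * nonempty_seq) (y : nat -> nonempty_seq).

Definition played_seqs x y : nat -> nonempty_seq :=
  fun k => if odd k then y k./2 else (x k./2).2.

Definition game_f x y : baire_space := concat (played_seqs x y).
Definition game_g x : baire_space := fun i => (x i).1.

Definition Gstarstar_p x y : Prop := B (game_f x y, game_g x).

End UnfoldedGame.

Definition proj_set (B : set (baire_space * baire_space)) : set baire_space :=
  [set f | exists g, B (f, g)].

(* Main.v *)
Require Import Defs.
From mathcomp Require Import all_boot all_classical.
From mathcomp Require Import topology.

Local Open Scope classical_set_scope.

(** Both parts rest on the same diagonal set.  Suppose that at some moment of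
    the game the sequence built so far is [w], that the opponent of the
    strategy is to move, and that the strategy would answer a move [u] by
    [R u].  Call [f] refused at that moment when [f] extends [w] but no move
    [u] keeps the play, after the answer, inside [f].  The set [refused w R]
    of these [f] is nowhere dense ([nowhere_dense_refused]): a finite sequence
    incompatible with [w] already avoids it, and any other one can be
    prolonged to [w ++ u] and then to [w ++ u ++ R u].

    There are only countably many moments, because a moment is given by a
    finite list of rounds, and, when the strategy is that of Player II, by the
    number that Player I puts next into [g].  So the points refused at some
    moment form a meager set.  A point [f] that is never refused is the
    outcome of a play that follows the strategy: the opponent chooses at each
    moment a move that keeps the play inside [f].

    If the strategy wins for Player II and [(f, g)] is in [B], Player I can
    moreover play the values of [g], and would win; hence every point of [A]
    is refused at some moment, and [A] is meager.  If the strategy wins for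
    Player I and [u] is its opening sequence, every [f] extending [u] which is
    never refused is the outcome of a play won by Player I, so it belongs to
    [A]; hence [A] is comeager in the set of all extensions of [u]. *)

(** * Meager sets *)

Lemma nowhere_denseS (T : topologicalType) (A C : set T) :
  A `<=` C -> nowhere_dense C -> nowhere_dense A.
Proof.
move=> AC C0; rewrite /nowhere_dense -subset0 -C0.
exact/interiorS/closureS.
Qed.

Lemma nowhere_dense0 (T : topologicalType) : nowhere_dense (@set0 T).
Proof. by rewrite /nowhere_dense closure0 interior0. Qed.

Lemma meager_sub_bigcup (T : topologicalType) (I : countType)
    (F : I -> set T) (A : set T) :
  (forall i, nowhere_dense (F i)) -> A `<=` \bigcup_i F i -> meager A.
Proof.
move=> ndF AF.
exists (fun n => A `&` if unpickle n is Some i then F i else set0); split.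
  move=> n; apply: nowhere_denseS (@subIsetr _ _ _) _.
  by case: unpickle => [i|]; [exact: ndF | exact: nowhere_dense0].
rewrite -setI_bigcupr; apply/esym/setIidl => f /AF[i _ Fif].
by exists (pickle i) => //; rewrite pickleK.
Qed.

(** * Cylinders of the Baire space *)

Definition cylinder (s : seq nat) : set baire_space :=
  [set f | mkseq f (size s) = s].

Lemma take_mkseq (T : Type) (f : nat -> T) m n :
  m <= n -> take m (mkseq f n) = mkseq f m.
Proof. by move=> mn; rewrite /mkseq -map_take take_iota (minn_idPl mn). Qed.

Lemma cylinder_mkseq (f h : baire_space) n :
  cylinder (mkseq f n) h = (mkseq h n = mkseq f n).
Proof. by rewrite /cylinder /= size_mkseq. Qed.

Lemma cylinder_nth (s : seq nat) : cylinder s (nth 0 s).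
Proof. exact: mkseq_nth. Qed.

Lemma cylinder_catl s t : cylinder (s ++ t) `<=` cylinder s.
Proof.
move=> f /(congr1 (take (size s))).
by rewrite take_size_cat // take_mkseq // size_cat leq_addr.
Qed.

Lemma open_cylinder s : open (cylinder s).
Proof.
rewrite openE => f sf; rewrite /interior.
have coord (n : nat) : nbhs f [set h : baire_space | h n = f n].
  have := @proj_continuous nat (fun _ => nat) n f [set f n].
  by apply; exact: discrete_set1.
have init n : nbhs f [set h : baire_space | mkseq h n = mkseq f n].
  elim: n => [|n IHn]; first by apply: filterS filterT.
  apply: filterS (filterI IHn (coord n)) => h [/= hf hn].
  by rewrite !mkseqS hf hn.
apply: filterS (init (size s)) => h hf.
exact: (etrans hf sf).
Qed.

(** The filter generated by the cylinders around [f] converges to [f] in each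
    coordinate, because [nat] is discrete, hence in the product topology. *)
Lemma nbhs_cylinder (f : baire_space) (U : set baire_space) :
  nbhs f U -> exists n, cylinder (mkseq f n) `<=` U.
Proof.
pose F := filter_from [set: nat] (fun n => cylinder (mkseq f n)).
have FF : Filter F.
  apply: filter_from_filter; first by exists 0.
  move=> m n _ _; exists (maxn m n) => // h.
  rewrite /= !cylinder_mkseq => hf.
  by split; [have := congr1 (take m) hf | have := congr1 (take n) hf];
    rewrite !take_mkseq ?leq_maxl ?leq_maxr.
suff Ff : F --> f by move=> /Ff [n _ nU]; exists n.
apply/cvg_sup => i U' [/= _ [[V /= oV <- /= Vfi]]] /filterS; apply.
exists i.+1 => // h; rewrite cylinder_mkseq => /(congr1 (nth 0 ^~ i)).
by rewrite !nth_mkseq // => hi; rewrite /proj /= hi.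
Qed.

(** This is how nowhere density is checked below: every cylinder contains a
    smaller one that misses [A]. *)
Lemma nowhere_dense_avoid (A : set baire_space) :
  (forall s, exists t, cylinder (s ++ t) `&` A = set0) -> nowhere_dense A.
Proof.
move=> avoid; rewrite /nowhere_dense -subset0 => f /nbhs_cylinder[n nA].
have [t tA] := avoid (mkseq f n).
have ht := cylinder_nth (mkseq f n ++ t).
have [h [Ah th]] := nA _ (cylinder_catl _ _ _ ht) _
  (open_nbhs_nbhs (conj (open_cylinder _) ht)).
suff : set0 h by [].
by rewrite -tA.
Qed.

(** In a play that has built [w], [R u] is the answer of a fixed strategy to
    the move [u] of its opponent. *)
Definition refused (w : seq nat) (R : nonempty_seq -> seq nat) :
    set baire_space :=
  [set f | cylinder w f /\
           forall u : nonempty_seq, ~ cylinder (w ++ val u ++ R u) f].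

(** Any [s] compatible with [w] can be prolonged to a sequence [w ++ u]; the
    extensions of [w ++ u ++ R u] are not refused, since [u] is a good move
    for them. *)
Lemma nowhere_dense_refused w R : nowhere_dense (refused w R).
Proof.
apply: nowhere_dense_avoid => s.
have [[f [sf wf]]|sw] := pselect (cylinder s `&` cylinder w !=set0); last first.
  exists [::]; rewrite cats0 -subset0 => f [sf [wf _]].
  by apply: sw; exists f.
(* [s] and [w] are prolonged along a common extension [f] to the same length
   [m]; it exceeds the size of [w] strictly, so that [u] is nonempty. *)
have [m [sm wm]] : exists m, size s < m /\ size w < m.
  by exists (maxn (size s) (size w)).+1; rewrite !ltnS leq_maxl leq_maxr.
have prolong (v : seq nat) : cylinder v f -> size v < m ->
    v ++ drop (size v) (mkseq f m) = mkseq f m.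
  by move=> vf vm; rewrite -[RHS](cat_take_drop (size v)) take_mkseq ?vf // ltnW.
have u_neq0 : drop (size w) (mkseq f m) != [::].
  by rewrite -size_eq0 size_drop size_mkseq subn_eq0 -ltnNge.
pose u : nonempty_seq := exist _ (drop (size w) (mkseq f m)) u_neq0.
exists (drop (size s) (mkseq f m) ++ R u).
rewrite catA (prolong s sf sm) -(prolong w wf wm) -catA -subset0.
by move=> h [uh [_ no_answer]]; exact: no_answer u uh.
Qed.

(** * Plays and their outcomes *)

(** Recursion on the whole history: each round is computed by [next] from the
    list of the earlier ones, as strategies require. *)
Lemma exists_play (X Y : Type) (next : seq (X * Y) -> X * Y) :
  exists x y, forall i, (x i, y i) = next (rounds x y i).
Proof.
pose hist := fix hist n :=
  if n is m.+1 then rcons (hist m) (next (hist m)) else [::].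
exists (fun i => (next (hist i)).1), (fun i => (next (hist i)).2) => i.
rewrite -surjective_pairing; congr next; rewrite /rounds.
by elim: i => //= i IHi; rewrite mkseqS -IHi -surjective_pairing.
Qed.

Notation round := ((nat * nonempty_seq) * nonempty_seq)%type.

Definition position_seq (p : seq round) : seq nat :=
  flatten [seq val r.1.2 ++ val r.2 | r <- p].

Lemma position_seq_rcons p r :
  position_seq (rcons p r) = position_seq p ++ val r.1.2 ++ val r.2.
Proof. by rewrite /position_seq map_rcons flatten_rcons. Qed.

Lemma flatten_played_seqs x y n :
  flatten (mkseq (fun i => val (played_seqs x y i)) n.*2) =
  position_seq (rounds x y n).
Proof.
elim: n => // n IHn; rewrite doubleS !mkseqS !flatten_rcons IHn.
rewrite /rounds mkseqS position_seq_rcons /played_seqs /= odd_double /=.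
by rewrite uphalf_double doubleK catA.
Qed.

Lemma leq_size_position x y n : n <= size (position_seq (rounds x y n)).
Proof.
elim: n => // n IHn; rewrite /rounds mkseqS position_seq_rcons.
rewrite !size_cat addnC -addn1 addnC leq_add //=.
by case: (x n).2 => -[|? ?].
Qed.

(** The positions of a play have unbounded length, so they determine its
    outcome. *)
Lemma game_f_eq x y (f : baire_space) :
  (forall n, cylinder (position_seq (rounds x y n)) f) -> game_f x y = f.
Proof.
move=> along; apply: funext => k.
have lt_k := leq_size_position x y k.+1.
have := concat_prefix (played_seqs x y) k.+1.*2.
rewrite flatten_played_seqs; cbv zeta; rewrite -{2}(along k.+1).
move=> /(congr1 (nth 0 ^~ k)).
by rewrite !nth_mkseq.
Qed.

(** * Points refused by a winning strategy *)

Section Strategies.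
Variable B : set (baire_space * baire_space).

(** A moment at which Player I is to move consists of the completed rounds
    [m.1] and of the number [m.2] chosen for [g] in the coming round; once the
    number is fixed, only the sequence [u] remains to be found. *)
Definition refusedII (t : strategyII (nat * nonempty_seq) nonempty_seq)
    (m : seq round * nat) : set baire_space :=
  refused (position_seq m.1) (fun u => val (t m.1 (m.2, u))).

(** If [(f, g)] is in [B] and [f] is never refused, Player I defeats [t] by
    playing the values of [g] and, with them, sequences that keep the play
    inside [f]. *)
Lemma winningII_refused t :
  winningII (Gstarstar_p B) t -> proj_set B `<=` \bigcup_m refusedII t m.
Proof.
move=> win f [g Bfg]; apply: contrapT => not_refused.
(* The implication makes the choice function total; its premise holds at
   every position that the play built below reaches. *)
have move_in (m : seq round * nat) : exists u : nonempty_seq,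
    cylinder (position_seq m.1) f ->
    cylinder (position_seq m.1 ++ val u ++ val (t m.1 (m.2, u))) f.
  have [pf|] := pselect (cylinder (position_seq m.1) f); last first.
    by exists (exist _ [:: 0] isT).
  apply: contrapT => /forallNP no_u; apply: not_refused.
  by exists m => //; split=> // u uf; apply: (no_u u).
have [mv mvP] := choice move_in.
pose next (p : seq round) := (g (size p), mv (p, g (size p))).
have [x [y xyE]] :=
  exists_play _ _ (fun p : seq round => (next p, t p (next p))).
have xE i : x i = next (rounds x y i) := congr1 fst (xyE i).
apply: (win x y).
  by move=> i; rewrite xE; have /(congr1 snd) := xyE i.
have gE : game_g x = g.
  by apply: funext => i; rewrite /game_g xE /= size_mkseq.
rewrite /Gstarstar_p gE.
suff -> : game_f x y = f by [].
apply: game_f_eq; elim=> [|n IHn]; first by [].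
rewrite /rounds mkseqS -/(rounds x y n) position_seq_rcons xyE.
exact: mvP (rounds x y n, g (size (rounds x y n))) IHn.
Qed.

(** When Player II is to move after the completed rounds [p], the sequence
    built so far already includes the move [s p] of Player I. *)
Definition refusedI (s : strategyI (nat * nonempty_seq) nonempty_seq)
    (p : seq round) : set baire_space :=
  refused (position_seq p ++ val (s p).2)
          (fun v => val (s (rcons p (s p, v))).2).

(** If [f] extends the opening sequence of [s] and is never refused, Player II
    can steer the play to the outcome [f]; as [s] wins, the numbers it plays
    form a witness [g] with [(f, g)] in [B]. *)
Lemma winningI_refused s : winningI (Gstarstar_p B) s ->
  cylinder (val (s [::]).2) `\` proj_set B `<=` \bigcup_p refusedI s p.
Proof.
move=> win f [sf notBf]; apply: contrapT => not_refused; apply: notBf.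
pose stem p := position_seq p ++ val (s p).2.
have move_in p : exists v : nonempty_seq,
    cylinder (stem p) f -> cylinder (stem (rcons p (s p, v))) f.
  have [pf|] := pselect (cylinder (stem p) f); last first.
    by exists (exist _ [:: 0] isT).
  apply: contrapT => /forallNP no_v; apply: not_refused.
  exists p => //; split=> // v vf; apply: (no_v v) => _.
  by rewrite /stem position_seq_rcons /= -!catA; rewrite -!catA in vf.
have [mv mvP] := choice move_in.
have [x [y xyE]] := exists_play _ _ (fun p : seq round => (s p, mv p)).
exists (game_g x).
suff <- : game_f x y = f
  by apply: win => i; have /(congr1 fst) := xyE i.
apply: game_f_eq => n; apply: (@cylinder_catl _ (val (s (rounds x y n)).2)).
elim: n => [|n IHn]; first exact: sf.
by rewrite /rounds mkseqS -/(rounds x y n) xyE; exact: mvP IHn.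
Qed.

End Strategies.

Theorem theorem3p6p7 (A : set baire_space)
    (B : set (baire_space * baire_space)) (hA : A = proj_set B) :
  (I_has_winning_strategy (Gstarstar_p B) ->
     exists G : set baire_space, [/\ open G, G !=set0 & comeager_in G A]) /\
  (II_has_winning_strategy (Gstarstar_p B) -> meager A).
Proof.
rewrite hA; split=> [[s win]|[t win]].
  exists (cylinder (val (s [::]).2)); split.
  - exact: open_cylinder.
  - by exists (nth 0 (val (s [::]).2)); exact: cylinder_nth.
  - apply: meager_sub_bigcup (winningI_refused B s win).
    by move=> p; exact: nowhere_dense_refused.
apply: meager_sub_bigcup (winningII_refused B t win).
by move=> m; exact: nowhere_dense_refused.
Qed.
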